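(* Let $X$ be a paracompact space, let $Y$ be a metric space and let $f:X\to Y$ be a functionally fragmented map. Then: (1) $f$ is $\sigma$-discrete and functionally $F_\sigma$-measurable; (2) if $Y$ is a weak adhesive for $X$ and a locally weak adhesive for $X$, then $f$ is a Baire-one function; (3) if $X$ is Lindelöf, then $f$ is countably functionally fragmented.
   Context: Conventions. Paracompact spaces are understood to be Hausdorff. A subset $A$ of a topological space $X$ is functionally closed if $A=g^{-1}(0)$ for some continuous $g:X\to[0,1]$, and functionally open if its complement is functionally closed. Regular sequences. For an ordinal $\alpha$, a transfinite sequence $\mathscr U=(U_\xi:\xi\in[0,\alpha])$ of subsets of $X$ is regular in $X$ if: (a) each $U_\xi$ is open in $X$; (b) $U_0=\emptyset$, $U_\alpha=X$ and $U_\xi\subseteq U_\eta$ for all $0\le\xi\le\eta<\alpha$; (c) $U_\gamma=\bigcup_{\xi<\gamma}U_\xi$ for every limit ordinal $\gamma\in[0,\alpha]$. Fragmentability. Let $Y$ be a metric space, $f:X\to Y$ and $\varepsilon>0$. The map $f$ is $\varepsilon$-fragmented if every nonempty closed set $F\subseteq X$ contains a nonempty relatively open subset $U\subseteq F$ with $\operatorname{diam} f(U)<\varepsilon$; equivalently, there is a regular sequence $\mathscr U=(U_\xi:\xi\in[0,\alpha])$ in $X$ with $\operatorname{diam} f(U_{\xi+1}\setminus U_\xi)<\varepsilon$ for all $\xi\in[0,\alpha)$. Such a sequence is called $\varepsilon$-associated with $f$. The map $f$ is functionally $\varepsilon$-fragmented if there is a regular sequence $\varepsilon$-associated with $f$ all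 of whose members $U_\xi$ are functionally open in $X$. The map $f$ is functionally fragmented if it is functionally $\varepsilon$-fragmented for every $\varepsilon>0$. It is countably functionally fragmented if, for every $\varepsilon>0$, there is a countable (i.e. with $\alpha$ a countable ordinal) regular sequence $(U_\xi:\xi\in[0,\alpha])$ of functionally open sets that is $\varepsilon$-associated with $f$. Classes of maps. A map $f:X\to Y$ is Baire-one if it is the pointwise limit of a sequence of continuous maps $f_n:X\to Y$. It is functionally $F_\sigma$-measurable if for every open $V\subseteq Y$ the set $f^{-1}(V)$ is a union of a sequence of functionally closed subsets of $X$. A family $\mathscr A$ of subsets of $X$ is discrete if each point of $X$ has a neighborhood which intersects at most one set from $\mathscr A$. A family $\mathscr B$ of subsets of $X$ is a base for $f:X\to Y$ if for every open $V\subseteq Y$ there is a subfamily $\mathscr B_V\subseteq\mathscr B$ with $f^{-1}(V)=\bigcup_{B\in\mathscr B_V}B$. The map $f$ is $\sigma$-discrete if there is a sequence $(\mathscr B_n)_{n\in\omega}$ of discrete families of subsets of $X$ such that $\bigcup_{n\in\omega}\mathscr B_n$ is a base for $f$. Adhesives. A topological space $Y$ is a weak adhesive for $X$ if for any two points $y,z\in Y$ and any disjoint functionally closed sets $A,B\subseteq X$ there is a continuous map $h:X\to Y$ with $h|_A=y$ and $h|_B=z$ (constant on $A$ and on $B$). $Y$ is a locally weak adhesive for $X$ if for every $y\in Y$ and every neighborhood $V\subseteq Y$ of $y$ there is a neighborhood $U\subseteq V$ of $y$ such that for every $z\in U$ and any disjoint functionally closed sets $A,B\subseteq X$ there is a continuous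 map $h:X\to V$ with $h|_A=y$ and $h|_B=z$. *)

(* Defs.v *)
From HB Require Import structures.
From mathcomp Require Import all_boot all_order all_algebra.
From mathcomp Require Import boolp classical_sets cardinality wochoice.
From mathcomp Require Import reals constructive_ereal ereal topology normedtype.

Set Implicit Arguments.
Unset Strict Implicit.
Unset Printing Implicit Defensive.

Import Order.TTheory GRing.Theory Num.Theory.
Import numFieldNormedType.Exports.

Local Open Scope classical_set_scope.
Local Open Scope ring_scope.

Section covering_properties.
Context (X : topologicalType).
Implicit Types (C D : set (set X)).

Definition open_cover C := C `<=` open /\ \bigcup_(A in C) A = [set: X].

Definition refines D C := forall B, D B -> exists2 A, C A & B `<=` A.

Definition locally_finite C := forall x : X,
  exists2 V, nbhs x V & finite_set [set A | C A /\ A `&` V !=set0].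

Definition discrete_family C := forall x : X,
  exists2 V, nbhs x V & is_subset1 [set A | C A /\ A `&` V !=set0].

End covering_properties.

Definition paracompact (X : topologicalType) :=
  hausdorff_space X /\
  forall C : set (set X), open_cover C ->
    exists D : set (set X), [/\ open_cover D, refines D C & locally_finite D].

Definition lindelof (X : topologicalType) :=
  forall C : set (set X), open_cover C ->
    exists D : set (set X), [/\ D `<=` C, countable D & open_cover D].

Section functionally_closed_open.
Context (R : realType) (X : topologicalType).

Definition functionally_closed (A : set X) := exists g : X -> R,
  [/\ continuous g, forall x, 0 <= g x <= 1 & A = g @^-1` [set 0]].

Definition functionally_open (A : set X) := functionally_closed (~` A).

End functionally_closed_open.
Arguments functionally_closed R {X} A.
Arguments functionally_open R {X} A.

(* A closed interval of ordinals [0, alpha], up to order isomorphism: the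
   well-ordered sets with a greatest element are exactly these.  [oi_bot] is the
   ordinal 0 and [oi_top] is alpha; alpha is countable iff the carrier is. *)
Record ordinal_interval := OrdinalInterval {
  oi_sort :> Type ;
  oi_le : rel oi_sort ;
  oi_wo : well_order oi_le ;
  oi_bot : oi_sort ;
  oi_top : oi_sort ;
  oi_botP : forall i, oi_le oi_bot i ;
  oi_topP : forall i, oi_le i oi_top }.

Section ordinal_interval_theory.
Context (I : ordinal_interval).
Implicit Types i j k : I.

Definition oi_lt i j := oi_le i j /\ i <> j.

(* j = i + 1 *)
Definition oi_succ i j := oi_lt i j /\ forall k, oi_lt i k -> oi_le j k.

Definition oi_limit i := i <> oi_bot I /\ ~ exists j, oi_succ j i.

End ordinal_interval_theory.

Definition regular_sequence (X : topologicalType) (I : ordinal_interval)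
    (U : I -> set X) :=
  [/\ forall i, open (U i),
      U (oi_bot I) = set0,
      U (oi_top I) = [set: X],
      forall i j, oi_le i j -> oi_lt j (oi_top I) -> U i `<=` U j
    & forall i, oi_limit i -> U i = \bigcup_(j in [set j | oi_lt j i]) U j].

(* The value 0 is included so that the empty set has diameter 0. *)
Definition diameter (R : realType) (Y : metricType R) (A : set Y) : \bar R :=
  ereal_sup (0%:E |` [set (mdist p.1 p.2)%:E | p in A `*` A]).

Section fragmentability.
Context (R : realType) (X : topologicalType) (Y : metricType R).
Implicit Types (f : X -> Y) (eps : R).

Definition associated eps f (I : ordinal_interval) (U : I -> set X) :=
  regular_sequence U /\
  forall i j : I, oi_succ i j ->
    (diameter (f @` (U j `\` U i)) < eps%:E)%E.

Definition functionally_eps_fragmented eps f :=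
  exists (I : ordinal_interval) (U : I -> set X),
    associated eps f U /\ forall i, functionally_open R (U i).

Definition functionally_fragmented f :=
  forall eps, 0 < eps -> functionally_eps_fragmented eps f.

Definition countably_functionally_fragmented f :=
  forall eps, 0 < eps -> exists (I : ordinal_interval) (U : I -> set X),
    [/\ countable [set: I], associated eps f U
      & forall i, functionally_open R (U i)].

End fragmentability.

Section classes_of_maps.
Context (X Y : topologicalType).
Implicit Types f : X -> Y.

Definition baire_one f := exists fn : nat -> X -> Y,
  (forall n, continuous (fn n)) /\ forall x, fn n x @[n --> \oo] --> f x.

Definition functionally_Fsigma_measurable (R : realType) f :=
  forall V : set Y, open V -> exists F : nat -> set X,
    (forall n, functionally_closed R (F n)) /\ f @^-1` V = \bigcup_n F n.

Definition base_for f (B : set (set X)) :=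
  forall V : set Y, open V ->
    exists2 BV, BV `<=` B & f @^-1` V = \bigcup_(A in BV) A.

Definition sigma_discrete f := exists B : nat -> set (set X),
  (forall n, discrete_family (B n)) /\ base_for f (\bigcup_n B n).

End classes_of_maps.
Arguments functionally_Fsigma_measurable {X Y} R f.

Definition weak_adhesive (R : realType) (X Y : topologicalType) :=
  forall (y z : Y) (A B : set X),
    functionally_closed R A -> functionally_closed R B -> A `&` B = set0 ->
    exists h : X -> Y, [/\ continuous h,
      forall x, A x -> h x = y & forall x, B x -> h x = z].

Definition locally_weak_adhesive (R : realType) (X Y : topologicalType) :=
  forall (y : Y) (V : set Y), nbhs y V ->
    exists U : set Y, [/\ nbhs y U, U `<=` V &
      forall (z : Y) (A B : set X), U z ->
        functionally_closed R A -> functionally_closed R B -> A `&` B = set0 ->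
        exists h : X -> Y, [/\ continuous h, forall x, V (h x),
          forall x, A x -> h x = y & forall x, B x -> h x = z]].

(* Main.v *)
Require Import Defs.
From mathcomp Require Import all_boot all_order all_algebra.
From mathcomp Require Import lra.
From mathcomp Require Import boolp classical_sets cardinality wochoice.
From mathcomp Require Import reals constructive_ereal ereal topology normedtype.

Set Implicit Arguments.
Unset Strict Implicit.
Unset Printing Implicit Defensive.

Import Order.TTheory GRing.Theory Num.Theory.
Import numFieldNormedType.Exports.

Local Open Scope classical_set_scope.
Local Open Scope ring_scope.

(** Fix [eps] and a regular sequence of functionally open sets [U i] that is
    [eps]-associated with [f].  Its differences partition [X] into sets on
    which [f] oscillates by less than [eps], but this partition need not be
    sigma-discrete.  Everything rests on replacing it by a sigma-discrete cover
    by functionally closed sets.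

    A discrete family of functionally closed sets is encoded by a single
    continuous [phi : X -> [0, 1]] and a labelling [l] that is locally constant
    where [phi] does not vanish: the sets [{phi = 1, l = t}] form a discrete
    family, since near a zero of [phi] there is none of them and elsewhere [l] is
    locally constant ([discrete_labelled]); the union over any set of labels is
    functionally closed ([functionally_closed_labelled]); and a labelling whose
    choice depends on an earlier label is again a labelling
    ([labelled_bind]).  A sigma-discrete selection of a relation [Q] is a
    sequence of such labellings whose label at [x], where [phi x = 1], is
    related to [x] by [Q] ([sigma_selection]).

    In a paracompact space every open cover has a sigma-discrete selection: of
    each point, a member of the cover containing it ([paracompact_selection]).
    Hence selections that exist locally can be patched together
    ([sigma_selection_local]).  Transfinite induction along the [U i] then gives
    a selection of the relation [mdist (f x) y < eps]: a successor step adds one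
    difference [U j \ U i], a functionally F_sigma set on which one label
    suffices, and a limit step is a patching ([fragmented_selection]).

    For sigma-discreteness and measurability, selections for all [eps]
    approximate [f] well enough to write the preimage of an open set as a
    countable union of functionally closed sets [{phi = 1, l in S}].

    To prove that [f] is Baire-one, choose for each [n] a label [z] with [f x] in
    a neighbourhood [G n z] of [z] as provided by local weak adhesiveness at
    scale [2^-n], and merge the labellings of each selection into a sequence of
    labellings in which every point eventually has [phi x = 1]
    ([exhausting_selection]).  For a fixed
    stage, a continuous map with the coarsest labels as values is modified on
    smaller and smaller sets towards the finer labels, never moving by more than
    the current scale ([bridge_modification], [tower_approximation]).  The maps
    obtained for the successive stages converge to [f] pointwise.

    On a Lindelof space, discard from the given sequence the indices at
    which [U] repeats an earlier value.  A functionally open set inherits the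
    Lindelof property, so at a limit index countably many earlier values of [U]
    already fill [U]; by induction only countably many indices remain
    ([countable_fresh]). *)

(** * Preliminaries *)

(** A total, hence junk-valued off the image of [pickle], decoding of pairs. *)
Definition unpair (n : nat) : nat * nat := odflt (0%N, 0%N) (unpickle n).

Lemma unpairK : cancel pickle unpair.
Proof. by move=> p; rewrite /unpair pickleK. Qed.

Lemma filter_finite (I : choiceType) (T : Type) (F : set_system T) (J : set I)
    (P : I -> T -> Prop) :
  Filter F -> finite_set J -> (forall i, J i -> \forall x \near F, P i x) ->
  \forall x \near F, forall i, J i -> P i x.
Proof.
move=> FF /finite_fsetP[E ->] h.
by apply: filterS (filter_bigI FF h) => x Px i; exact: Px.
Qed.

Lemma countable_setU (T : Type) (A B : set T) :
  countable A -> countable B -> countable (A `|` B).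
Proof.
move=> cA cB.
apply: (@sub_countable _ _ _ (\bigcup_n (if n is 0%N then A else B))).
  by apply: subset_card_le => x [Ax|Bx]; [exists 0%N|exists 1%N].
by apply: bigcup_countable => // -[].
Qed.

Section clamp.
Context (R : realType).
Implicit Types s t : R.

Definition clamp (t : R) := Num.max 0 (Num.min 1 t).

Lemma clamp_itv t : 0 <= clamp t <= 1.
Proof. by rewrite /clamp le_max lexx/= ge_max ler01/= ge_min lexx. Qed.

Lemma clamp_le0 t : t <= 0 -> clamp t = 0.
Proof. by move=> t0; rewrite /clamp (min_idPr _) ?(max_idPl _)//; lra. Qed.

Lemma clamp_ge1 t : 1 <= t -> clamp t = 1.
Proof. by move=> t1; rewrite /clamp (min_idPl t1) (max_idPr ler01). Qed.

Lemma clamp_neq0 t : clamp t != 0 -> 0 < t.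
Proof. by rewrite ltNge; apply: contra_neqN => /clamp_le0. Qed.

Lemma clamp_eq1 t : clamp t = 1 -> 1 <= t.
Proof.
rewrite /clamp /Num.max /Num.min; case: (ltP 1 t) => [/ltW//|_].
by case: ltP => [_ ->|_ /esym/eqP]; rewrite ?oner_eq0.
Qed.

Lemma clamp_dist s t : `|clamp s - clamp t| <= `|s - t|.
Proof.
wlog st : s t / s <= t.
  move=> h; have [/h//|/ltW/h] := leP s t.
  by rewrite distrC [`|t - s|]distrC.
have cst : clamp s <= clamp t.
  by rewrite /clamp; apply: le_max2 => //; apply: le_min2.
rewrite distrC [leRHS]distrC !ger0_norm ?subr_ge0//.
rewrite /clamp /Num.max /Num.min.
by repeat case: ifPn; rewrite -?leNgt; lra.
Qed.

End clamp.

Lemma continuous_dist (R : realType) (X : topologicalType) (phi : X -> R) :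
  (forall x e, 0 < e -> \forall y \near x, `|phi x - phi y| < e) ->
  continuous phi.
Proof. by move=> h x; apply/cvgrPdist_lt => e e0; exact: h. Qed.

Lemma clamp_continuous (R : realType) : continuous (@clamp R).
Proof.
apply: continuous_dist => t e e0.
have /cvgrPdist_lt /(_ e e0) : id @ t --> t by exact: cvg_id.
by apply: filterS => s; apply: le_lt_trans; exact: clamp_dist.
Qed.

Section real_functions.
Context (R : realType) (X : topologicalType).
Implicit Types (phi u : X -> R).

Lemma continuous_clamp u : continuous u -> continuous (fun x => clamp (u x)).
Proof.
by move=> cu x; apply: continuous_comp; [exact: cu|exact: clamp_continuous].
Qed.

Lemma functionally_openP (U : set X) : functionally_open R U ->
  exists g : X -> R, [/\ continuous g, forall x, 0 <= g x <= 1
    & forall x, U x <-> 0 < g x].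
Proof.
move=> [g [cg bg Ug]]; exists g; split=> // x.
have gx0 : (~` U) x <-> g x = 0 by rewrite Ug.
have /andP[g0 _] := bg x; split=> [Ux|gx].
  by rewrite lt_neqAle g0 andbT; apply/eqP => /esym /gx0.
by apply: contrapT => /gx0 h; move: gx; rewrite h ltxx.
Qed.

Lemma functionally_closed_le0 u : continuous u ->
  functionally_closed R [set x | u x <= 0].
Proof.
move=> cu; exists (fun x => clamp (u x)); split.
- exact: continuous_clamp.
- by move=> x; exact: clamp_itv.
- apply/seteqP; split=> x /=; first exact: clamp_le0.
  by move=> e; rewrite leNgt; apply/negP => ux; move/eqP: e; apply/negP;
    rewrite /clamp gt_eqF// lt_max lt_min ux ltr01 orbT.
Qed.

End real_functions.

(** * Well-orders *)

Section well_orders.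
Context (T : Type) (le : rel T).
Hypothesis wo : well_order le.
Implicit Types (x y z : T) (P : T -> Prop).

Lemma wo_min P : (exists x, P x) -> exists z, P z /\ forall y, P y -> le z y.
Proof.
move=> [x Px]; have [|z [[+ lbz] _]] := wo (A := [pred x | `[< P x >]]).
  by exists x; apply/asboolP.
move=> /asboolP Pz; exists z; split=> // y Py; apply: lbz; exact/asboolP.
Qed.

Lemma wo_total x y : le x y \/ le y x.
Proof.
have [|z [[->|->] hz]] := @wo_min (fun z => z = x \/ z = y).
- by exists x; left.
- by left; apply: hz; right.
- by right; apply: hz; left.
Qed.

Lemma wo_refl x : le x x.
Proof. by case: (wo_total x x). Qed.

Lemma wo_anti x y : le x y -> le y x -> x = y.
Proof.
move=> xy yx; have [|z [_ uz]] := wo (A := [pred z | `[< z = x \/ z = y >]]).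
  by exists x; apply/asboolP; left.
have ex : z = x.
  by apply: uz; split=> [|w /asboolP[]->//]; [apply/asboolP; left|exact: wo_refl].
rewrite -ex; apply: uz; split=> [|w /asboolP[]->//]; last exact: wo_refl.
by apply/asboolP; right.
Qed.

Lemma wo_trans x y z : le x y -> le y z -> le x z.
Proof.
move=> xy yz; have [|w [hw lew]] := @wo_min (fun w => [\/ w = x, w = y | w = z]).
  by exists x; constructor 1.
have lewx : le w x by apply: lew; constructor 1.
have lewy : le w y by apply: lew; constructor 2.
have lewz : le w z by apply: lew; constructor 3.
case: hw => e; rewrite e in lewx lewy lewz.
- by [].
- by rewrite (wo_anti xy lewx).
- by rewrite -(wo_anti yz lewy).
Qed.

End well_orders.

Section ordinal_intervals.
Context (I : ordinal_interval).
Implicit Types i j : I.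

Lemma oi_ltNge i j : ~ oi_le i j <-> oi_lt j i.
Proof.
have wo := @oi_wo I; split=> [nij|[ji j_neqi] ij]; last first.
  by apply: j_neqi; exact: (wo_anti wo).
have [//|ji] := wo_total wo i j; split=> // ji_eq.
by apply: nij; rewrite ji_eq; exact: wo_refl.
Qed.

Lemma oi_ind (P : I -> Prop) :
  P (oi_bot I) -> (forall i j, oi_succ i j -> P i -> P j) ->
  (forall i, oi_limit i -> (forall j, oi_lt j i -> P j) -> P i) ->
  forall i, P i.
Proof.
move=> P0 PS Pl i; apply: contrapT => nPi.
have wo := @oi_wo I.
have [|k [nPk mink]] := wo_min wo (P := fun i => ~ P i); first by exists i.
have Plt j : oi_lt j k -> P j.
  move=> [jk j_neqk]; apply: contrapT => /mink kj; apply: j_neqk.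
  exact: wo_anti jk kj.
apply: nPk; have [->//|k_neq0] := pselect (k = oi_bot I).
have [[j jk]|no] := pselect (exists j, oi_succ j k); last exact: Pl.
by apply: (PS _ _ jk); apply: Plt; case: jk.
Qed.

End ordinal_intervals.

(** * Labellings: discrete families encoded by one function *)

Section labelled.
Context (R : realType) (X : topologicalType).
Implicit Types (phi psi : X -> R) (x y : X).

(** Only the behaviour of [l] where [phi] does not vanish matters, so the same
    encoding serves for the cut-down families [{phi >= t, l = _}], [0 < t]. *)
Definition labelled T phi (l : X -> T) :=
  [/\ continuous phi, forall x, 0 <= phi x <= 1
    & forall x, phi x != 0 -> \forall y \near x, l y = l x].

Lemma labelled_cst T (t : T) : labelled (fun=> 1 : R) (fun=> t).
Proof.
split=> [x|x|x _]; first exact: cvg_cst.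
- by rewrite ler01 lexx.
- exact: filterE.
Qed.

Lemma labelled0 T (l : X -> T) : labelled (fun=> 0 : R) l.
Proof.
split=> [x|x|x]; first exact: cvg_cst.
- by rewrite ler01 lexx.
- by rewrite eqxx.
Qed.

Lemma labelled_mono T1 T2 phi (l1 : X -> T1) (l2 : X -> T2) :
  labelled phi l1 -> (forall x y, l1 x = l1 y -> l2 x = l2 y) ->
  labelled phi l2.
Proof.
move=> [c b h] l12; split=> // x /h; apply: filterS => y; exact: l12.
Qed.

(** Where [phi] does not vanish the index [l x] is locally constant, and near a
    zero of [phi] the product is small because every [psi t] is bounded by 1;
    so continuity survives although [psi (l x)] may jump from point to point. *)
Lemma labelled_bind T1 T2 phi (l : X -> T1) (psi : T1 -> X -> R)
    (l' : T1 -> X -> T2) :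
  labelled phi l -> (forall t, labelled (psi t) (l' t)) ->
  labelled (fun x => phi x * psi (l x) x) (fun x => l' (l x) x).
Proof.
move=> [cphi bphi lphi] lpsi.
have bpsi t x : 0 <= psi t x <= 1 by case: (lpsi t).
split=> [||x].
- apply: continuous_dist => x e e0.
  have [phi0|/lphi lx] := eqVneq (phi x) 0.
    have /cvgrPdist_lt /(_ e e0) := cphi x.
    apply: filterS => y; rewrite phi0 mul0r !sub0r !normrN normrM.
    apply: le_lt_trans; rewrite ler_piMr// ger0_norm.
      by case/andP: (bpsi (l y) y).
    by case/andP: (bpsi (l y) y).
  have cm : {for x, continuous (fun y => phi y * psi (l x) y)}.
    by apply: continuousM; [exact: cphi|case: (lpsi (l x)) => c _ _; exact: c].
  have /cvgrPdist_lt /(_ e e0) := cm.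
  by apply: filterS2 lx => y ->.
- move=> x; have /andP[p0 p1] := bphi x; have /andP[q0 q1] := bpsi (l x) x.
  by rewrite mulr_ge0// mulr_ile1.
- rewrite mulf_eq0 negb_or => /andP[/lphi lx psi0].
  have [_ _ /(_ _ psi0)] := lpsi (l x).
  by apply: filterS2 lx => y ->.
Qed.

Lemma labelled_filter T phi (l : X -> T) (S : T -> Prop) :
  labelled phi l -> labelled (fun x => phi x * (`[< S (l x) >])%:R) l.
Proof.
move=> lphi.
apply: (labelled_bind (psi := fun t _ => `[< S t >]%:R) (l' := fun t _ => t)) => // t.
have [_|_] := asboolP (S t); [exact: labelled_cst | exact: labelled0].
Qed.

Lemma labelled_pair T1 T2 phi psi (l1 : X -> T1) (l2 : X -> T2) :
  labelled phi l1 -> labelled psi l2 ->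
  labelled (fun x => phi x * psi x) (fun x => (l1 x, l2 x)).
Proof.
move=> h1 h2.
apply: (labelled_bind (psi := fun _ => psi) (l' := fun t x => (t, l2 x))) => // t.
by apply: labelled_mono h2 _ => x y ->.
Qed.

Lemma labelled_comp T phi (l : X -> T) (g : R -> R) :
  continuous g -> (forall t, 0 <= t <= 1 -> 0 <= g t <= 1) -> g 0 = 0 ->
  labelled phi l -> labelled (g \o phi) l.
Proof.
move=> cg bg g0 [c b h]; split=> [x|x|x /=].
- by apply: continuous_comp; [exact: c|exact: cg].
- exact: bg.
- by move=> g_neq0; apply: h; apply: contra_neq g_neq0 => ->.
Qed.

Lemma functionally_closed_labelled T phi (l : X -> T) (S : T -> Prop) :
  labelled phi l -> functionally_closed R [set x | phi x = 1 /\ S (l x)].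
Proof.
move=> /(labelled_filter S)[c b _].
exists (fun x => 1 - phi x * (`[< S (l x) >])%:R); split.
- by move=> x; apply: cvgB; [exact: cvg_cst|exact: c].
- by move=> x; have := b x; lra.
- apply/seteqP; split => x /=.
    by case=> -> /asboolP ->; rewrite mulr1 subrr.
  have [Sl|_] := asboolP (S (l x)); rewrite ?mulr1 ?mulr0.
    by move=> h; split=> //; lra.
  by move=> h; exfalso; lra.
Qed.

Lemma discrete_labelled T phi (l : X -> T) (S : set T) :
  labelled phi l ->
  discrete_family [set A | exists2 t, S t & A = [set x | phi x = 1 /\ l x = t]].
Proof.
move=> [c b h] x; have [phi0|/h lx] := eqVneq (phi x) 0.
  have /cvgrPdist_lt /(_ 1 ltr01) hx := c x.
  exists [set y | `|phi x - phi y| < 1] => // A B [[t St ->]] [y [[]]].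
  by rewrite /= phi0 => ->; rewrite sub0r normrN normr1 ltxx.
exists [set y | l y = l x] => // A B /= [[t St ->]] [y [[_ <-] ->]].
by move=> [[s Ss ->]] [z [[_ <-] ->]].
Qed.

(** A family of functions with disjoint cozero sets amounts to one labelling,
    the label being the index of the function that does not vanish.  The
    equicontinuity assumption makes the glued function continuous. *)
Lemma labelled_family (I : Type) (psi : I -> X -> R) (i0 : I) :
  (forall i x, 0 <= psi i x <= 1) ->
  (forall x e, 0 < e -> \forall y \near x, forall i, `|psi i x - psi i y| < e) ->
  (forall i j x, psi i x != 0 -> psi j x != 0 -> i = j) ->
  exists (phi : X -> R) (l : X -> I), [/\ labelled phi l,
    forall x, phi x = psi (l x) x & forall i x, psi i x != 0 -> l x = i].
Proof.
move=> bpsi ec dis.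
have /choice[l hl] x : exists i, forall j, psi j x != 0 -> i = j.
  have [[i hi]|no] := pselect (exists i, psi i x != 0).
    by exists i => j; exact: dis.
  by exists i0 => j hj; case: no; exists j.
have lx x : psi (l x) x != 0 -> \forall y \near x, l y = l x.
  move=> h; have h0 : 0 < psi (l x) x.
    by rewrite lt_neqAle eq_sym h; case/andP: (bpsi (l x) x).
  apply: filterS (ec x _ h0) => y /(_ (l x)) hy; apply: hl.
  by apply/eqP => psiy; move: hy; rewrite psiy subr0 gtr0_norm// ltxx.
exists (fun x => psi (l x) x), l; split=> //; last by move=> i x; exact: hl.
split=> //; apply: continuous_dist => x e e0.
have [psi0|/lx] := eqVneq (psi (l x) x) 0; last first.
  by apply: filterS2 (ec x _ e0) => y /(_ (l x)) + ->.
apply: filterS (ec x _ e0) => y /(_ (l y)); rewrite psi0.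
suff -> : psi (l y) x = 0 by [].
by apply: contrapT => /eqP h; move: psi0; rewrite (hl _ _ h); exact/eqP.
Qed.

End labelled.

(** * Sigma-discrete selections *)

Section sigma_selection.
Context (R : realType) (X : topologicalType).
Implicit Types (U V : set X).

(** The labels satisfy [Q] on the whole of the sets [{phi n = 1}], even outside
    [U]: so a selection on [U] is one on every subset of [U], and [U] may be an
    arbitrary set. *)
Definition sigma_selection T (Q : X -> T -> Prop) (U : set X) :=
  exists (phi : nat -> X -> R) (l : nat -> X -> T),
  [/\ forall n, labelled (phi n) (l n),
      forall n x, phi n x = 1 -> Q x (l n x)
    & forall x, U x -> exists n, phi n x = 1].

Lemma sigma_selection0 T (Q : X -> T -> Prop) (l : X -> T) :
  sigma_selection Q set0.
Proof.
exists (fun _ _ => 0), (fun=> l); split=> // [n|n x /esym/eqP].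
  exact: labelled0.
by rewrite oner_eq0.
Qed.

Lemma sigma_selectionW T (Q : X -> T -> Prop) U V :
  V `<=` U -> sigma_selection Q U -> sigma_selection Q V.
Proof.
by move=> VU [phi [l [h1 h2 h3]]]; exists phi, l; split=> // x /VU /h3.
Qed.

Lemma sigma_selection_bigcup T (Q : X -> T -> Prop) (U : nat -> set X) :
  (forall n, sigma_selection Q (U n)) -> sigma_selection Q (\bigcup_n U n).
Proof.
move=> /choice[phi /choice[l h]].
exists (fun p => phi (unpair p).1 (unpair p).2),
  (fun p => l (unpair p).1 (unpair p).2); split=> [p|p x|x [n _ Unx]].
- by case: (h (unpair p).1).
- by case: (h (unpair p).1) => _ + _; apply.
- have [_ _ /(_ _ Unx)[m hm]] := h n.
  by exists (pickle (n, m)); rewrite unpairK.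
Qed.

Lemma sigma_selectionU T (Q : X -> T -> Prop) U V :
  sigma_selection Q U -> sigma_selection Q V -> sigma_selection Q (U `|` V).
Proof.
move=> hU hV; apply: (sigma_selectionW (U := \bigcup_n (if n is 0 then U else V))).
  by move=> x [Ux|Vx]; [exists 0%N|exists 1%N].
by apply: sigma_selection_bigcup; case.
Qed.

(** Once a first selection has chosen a label [t] at [x], a second selection
    that depends on [t] may be used near [x].  The map [l0] supplies junk labels
    for those [t] that [Q1] never selects. *)
Lemma sigma_selection_bind T1 T2 (Q1 : X -> T1 -> Prop) (Q2 : X -> T2 -> Prop)
    (l0 : X -> T2) U :
  sigma_selection Q1 U ->
  (forall x t, Q1 x t ->
     exists2 W, sigma_selection Q2 W & U `&` [set y | Q1 y t] `<=` W) ->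
  sigma_selection Q2 U.
Proof.
move=> [phi [l [h1 h2 h3]]] hW.
have /choice[f /choice[g hfg]] t : exists (psi : nat -> X -> R) (l' : nat -> X -> T2),
  [/\ forall n, labelled (psi n) (l' n),
      forall n x, psi n x = 1 -> Q2 x (l' n x)
    & forall x, U x -> Q1 x t -> exists n, psi n x = 1].
  have [[x Qxt]|no] := pselect (exists x, Q1 x t).
    have [W [psi [l' [k1 k2 k3]]] QW] := hW x t Qxt.
    by exists psi, l'; split=> // y Uy Qy; apply: k3; apply: QW.
  have [psi [l' [k1 k2 k3]]] := sigma_selection0 Q2 l0.
  by exists psi, l'; split=> // y Uy Qy; case: no; exists y.
exists (fun p x => phi (unpair p).1 x * f (l (unpair p).1 x) (unpair p).2 x),
  (fun p x => g (l (unpair p).1 x) (unpair p).2 x); split=> [p|p x|x Ux].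
- apply: (labelled_bind (psi := fun t => f t (unpair p).2)
    (l' := fun t => g t (unpair p).2)) => // t.
  by case: (hfg t).
- case: (hfg (l (unpair p).1 x)) => f1 f2 _ eq1; apply: f2.
  have [_ /(_ x)/andP[p0 p1] _] := h1 (unpair p).1.
  have [_ /(_ x)/andP[q0 q1] _] := f1 (unpair p).2.
  by apply/le_anti; rewrite q1 -eq1 ler_piMl.
- have [n hn] := h3 x Ux.
  have [_ _ /(_ x Ux (h2 _ _ hn))[m hm]] := hfg (l n x).
  by exists (pickle (n, m)); rewrite unpairK/= hn hm mul1r.
Qed.

End sigma_selection.

(** * Open covers of paracompact spaces *)

Section paracompact_normal.
Context (X : topologicalType).
Implicit Types (C D S : set (set X)) (A B K L : set X).

Lemma nbhs_notin_closure x B : ~ closure B x -> nbhs x (~` B).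
Proof.
move=> nc; apply: contrapT => h; apply: nc => W nW.
apply: contrapT => BW; apply: h; apply: filterS nW => y Wy By.
by apply: BW; exists y.
Qed.

(** The union of the closures of a locally finite family is closed. *)
Lemma locally_finite_nbhs D S x : locally_finite D -> S `<=` D ->
  (forall B, S B -> ~ closure B x) -> nbhs x (~` \bigcup_(B in S) B).
Proof.
move=> /(_ x)[V nV finV] SD nc.
have h A : [set A | D A /\ A `&` V !=set0] A -> \forall y \near x, S A -> ~ A y.
  move=> _; have [SA|nSA] := pselect (S A); last exact: filterE.
  by apply: filterS (nbhs_notin_closure (nc _ SA)).
have finh := filter_finite (nbhs_filter x) finV h.
apply: filterS2 nV finh => y Vy hy [A SA Ay]; apply: (hy A) => //.
by split; [exact: SD|exists y].
Qed.

(** With [L] a point this turns Hausdorff separation into regularity, and then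
    with [L] closed it turns regularity into normality.  The points of [K] have
    neighbourhoods whose closures miss [L]; a locally finite refinement of them
    covers [K] by an open set whose closure still misses [L]. *)
Lemma paracompact_separation K L : paracompact X -> closed K ->
  (forall x, K x ->
     exists A B, [/\ open A, A x, open B, L `<=` B & A `&` B = set0]) ->
  exists A B, [/\ open A, K `<=` A, open B, L `<=` B & A `&` B = set0].
Proof.
move=> [_ hX] cK sepK.
pose C := [set A | open A /\ ((exists B, [/\ open B, L `<=` B & A `&` B = set0]) \/
  A `&` K = set0)].
have covC : open_cover C.
  split=> [A []//|]; apply/seteqP; split=> // x _.
  have [/sepK [A [B [oA Ax oB LB AB]]]|nKx] := pselect (K x).
    by exists A => //; split=> //; left; exists B.
  by exists (~` K) => //; split; [exact: closed_openC|right; rewrite setICl].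
have [D [[oD covD] DC lfD]] := hX C covC.
pose S := [set B | D B /\ B `&` K !=set0].
have nclS B : S B -> forall y, L y -> ~ closure B y.
  move=> [DB [z [Bz Kz]]] y Ly.
  have [A [_ [[B' [oB' LB' AB']]|AK]] BA] := DC _ DB; last first.
    by have : set0 z by rewrite -AK; split=> //; exact: BA.
  move=> /(_ B' (open_nbhs_nbhs (conj oB' (LB' _ Ly))))[w [Bw B'w]].
  by have : set0 w by rewrite -AB'; split=> //; exact: BA.
exists (\bigcup_(B in S) B), (interior (~` \bigcup_(B in S) B)); split.
- by apply: bigcup_open => B [/oD].
- move=> x Kx; have : [set: X] x by [].
  by rewrite -covD => -[B DB Bx]; exists B => //; split=> //; exists x.
- exact: open_interior.
- move=> y Ly; apply: (locally_finite_nbhs lfD); first by move=> B [].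
  by move=> B SB; exact: nclS.
- by apply/seteqP; split=> // y [Sy /interior_subset].
Qed.

Lemma paracompact_separation_closed K L : paracompact X -> closed K ->
  closed L -> K `&` L = set0 ->
  exists A B, [/\ open A, K `<=` A, open B, L `<=` B & A `&` B = set0].
Proof.
move=> hX cK cL KL; apply: (paracompact_separation hX cK) => x Kx.
suff [A [B [oA LA oB xB AB]]] : exists A B, [/\ open A, L `<=` A, open B,
    [set x] `<=` B & A `&` B = set0].
  by exists B, A; split=> //; [exact: xB|rewrite setIC].
apply: (paracompact_separation hX cL) => y Ly.
have xy : x != y.
  by apply/eqP => xy; have : set0 x by rewrite -KL; split=> //; rewrite xy.
move: (hX.1); rewrite open_hausdorff => /(_ x y xy)[[A B]/= [xA yB] [oA oB AB]].
exists B, A; split=> //.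
- exact: set_mem.
- by move=> _ ->; exact: set_mem.
- by rewrite setIC; apply/eqP.
Qed.

Lemma paracompact_normal (R : realType) : paracompact X -> normal_space X.
Proof.
move=> hX; apply/(normal_openP (R := R)) => K L cK cL KL.
have [A [B [oA KA oB LB AB]]] := paracompact_separation_closed hX cK cL KL.
by exists A, B.
Qed.

Lemma paracompact_shrink C : paracompact X -> open_cover C ->
  open_cover [set B | open B /\ exists2 A, C A & closure B `<=` A].
Proof.
move=> hX [oC covC]; split=> [B []//|]; apply/seteqP; split=> // x _.
have : [set: X] x by [].
rewrite -covC => -[A CA Ax].
have [||| U [V [oU xU oV AV UV]]] :=
    @paracompact_separation_closed [set x] (~` A) hX.
- exact/accessible_closed_set1/hausdorff_accessible/hX.1.
- exact/open_closedC/oC.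
- by apply/seteqP; split=> // y [-> ]; exact.
exists U; last exact: xU.
split=> //; exists A => // y cUy; apply: contrapT => nAy.
have [w [Uw Vw]] := cUy V (open_nbhs_nbhs (conj oV (AV _ nAy))).
by have : set0 w by rewrite -UV.
Qed.

(** As in the construction of a partition of unity: [D] is shrunk to a cover [E]
    by sets whose closures lie in members of [D], and [phi A] separates from the
    complement of [A] the closure of the union of the members of [E] assigned to
    [A], which local finiteness keeps inside [A]. *)
Lemma paracompact_functions (R : realType) C : paracompact X -> open_cover C ->
  exists (D : set (set X)) (phi : set X -> X -> R),
  [/\ open_cover D, locally_finite D, refines D C
    & [/\ forall A, continuous (phi A),
      forall A x, 0 <= phi A x <= 1,
      forall A x, phi A x != 0 -> D A /\ A x
    & forall x, exists A, phi A x = 1]].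
Proof.
move=> hX covC; have [_ hX'] := hX.
have [D [covD DC lfD]] := hX' C covC.
have [E [covE ED lfE]] := hX' _ (paracompact_shrink hX covD).
pose S A := [set B | E B /\ closure B `<=` A].
pose K A := closure (\bigcup_(B in S A) B).
have KA A : K A `<=` A.
  move=> x; apply: contraPP => nAx cx.
  have /cx [y [Sy]] // : nbhs x (~` \bigcup_(B in S A) B).
  apply: locally_finite_nbhs lfE _ _; first by move=> B [].
  by move=> B [_ BA] cBx; apply/nAx/BA.
pose phi A := if pselect (D A) then Urysohn (R := R) (~` A) (K A) else fun=> 0.
have sep A : D A -> uniform_separator (~` A) (K A).
  move=> DA; apply: normal_uniform_separator.
  - exact: (paracompact_normal R).
  - exact/open_closedC/covD.1.
  - exact: closed_closure.
  - by apply/seteqP; split=> // x [nAx /KA].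
exists D, phi; split=> //; split=> [A|A x|A x|x].
- rewrite /phi; case: pselect => [?|?]; first exact: Urysohn_continuous.
  by move=> x; exact: cvg_cst.
- rewrite /phi; case: pselect => [?|?]; last by rewrite ler01 lexx.
  have /Urysohn_range : range (Urysohn (R := R) (~` A) (K A)) (Urysohn (~` A) (K A) x).
    by exists x.
  by rewrite /= in_itv/=.
- rewrite /phi; case: pselect => [DA|?]; last by rewrite eqxx.
  move=> h; split=> //; apply: contrapT => nAx; move/eqP: h; apply.
  by apply: (Urysohn_sub0 (sep A DA)); exists x.
- have : [set: X] x by [].
  rewrite -covE.2 => -[B EB Bx].
  have [B' [oB' [A DA BA]] BB'] := ED _ EB.
  exists A; rewrite /phi; case: pselect => // ?.
  apply: (Urysohn_sub1 (sep A DA)); exists x => //.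
  apply: subset_closure; exists B => //; split=> //.
  exact: subset_trans (closure_subset BB') BA.
Qed.

End paracompact_normal.

Section paracompact_selection.
Context (R : realType) (X : topologicalType).

Lemma inf_dist (I : Type) (S : set I) (u v : I -> R) e : S !=set0 ->
  (forall i, 0 <= u i) -> (forall i, 0 <= v i) ->
  (forall i, S i -> `|u i - v i| <= e) ->
  `|inf (u @` S) - inf (v @` S)| <= e.
Proof.
move=> [i0 Si0].
suff half (w z : I -> R) : (forall i, 0 <= w i) ->
    (forall i, S i -> `|w i - z i| <= e) -> inf (w @` S) - e <= inf (z @` S).
  move=> u0 v0 uv; rewrite ler_norml; apply/andP; split.
    rewrite lerNl opprB lerBlDr addrC -lerBlDr; apply: half => // i Si.
    by rewrite distrC; exact: uv.
  by rewrite lerBlDr addrC -lerBlDr; exact: half.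
move=> w0 wz; apply: lb_le_inf; first by exists (z i0), i0.
move=> _ [i Si <-]; rewrite lerBlDr.
have : inf (w @` S) <= w i.
  by apply: ge_inf; [exists 0 => _ [j _ <-]|exists i].
move=> h; apply: (le_trans h); rewrite addrC -lerBlDr.
exact: le_trans (ler_norm _) (wz _ Si).
Qed.

Lemma locally_finite_equicontinuous (D : set (set X)) (phi : set X -> X -> R) :
  locally_finite D -> (forall A, continuous (phi A)) ->
  (forall A x, phi A x != 0 -> D A /\ A x) ->
  forall x e, 0 < e -> \forall y \near x, forall A, `|phi A x - phi A y| < e.
Proof.
move=> lfD cphi Dphi x e e0; have [V nV finV] := lfD x.
have h A : [set A | D A /\ A `&` V !=set0] A ->
    \forall y \near x, `|phi A x - phi A y| < e.
  by move=> _; have /cvgrPdist_lt := cphi A x; apply.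
have finh := filter_finite (nbhs_filter x) finV h.
have Vx := nbhs_singleton nV.
apply: filterS2 nV finh => y Vy hy A.
have [phix|phix] := eqVneq (phi A x) 0; last first.
  by have [DA Ax] := Dphi _ _ phix; apply: hy; split=> //; exists x.
have [phiy|phiy] := eqVneq (phi A y) 0; first by rewrite phix phiy subr0 normr0.
by have [DA Ay] := Dphi _ _ phiy; apply: hy; split=> //; exists y.
Qed.

(** This is Stone's argument.  Well-order the index set of a locally finite
    family of functions; at level [n], the points where [phi A] is at least
    [1 / (n + 1)] and the functions preceding [phi A] vanish form a discrete
    family indexed by [A]. *)
Lemma paracompact_selection (C : set (set X)) :
  paracompact X -> open_cover C ->
  sigma_selection R (fun x A => C A /\ A x) [set: X].
Proof.
move=> hX covC.
have [D [phi [covD lfD DC [cphi bphi Dphi phi1]]]] :=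
  paracompact_functions R hX covC.
have ec := locally_finite_equicontinuous lfD cphi Dphi.
have [le wo] := well_ordering_principle (set X).
(* [psi n A] is positive only if [2 (n + 1) phi A] exceeds 1 while all the
   [2 (n + 1) phi B] for [B] before [A] are below 1: two indices cannot do
   this at the same point. *)
pose c n (A B : set X) x := clamp (if B == A then n.+1%:R * phi A x *+ 2 - 1
  else 1 - n.+1%:R * phi B x *+ 2).
pose psi n (A : set X) x := inf ((fun B => c n A B x) @` [set B | le B A]).
have bc n A B x : 0 <= c n A B x <= 1 by exact: clamp_itv.
have c0 n A B x : 0 <= c n A B x by case/andP: (bc n A B x).
have c1 n A B x : c n A B x <= 1 by case/andP: (bc n A B x).
have psi_le n A B x : le B A -> psi n A x <= c n A B x.
  by move=> BA; apply: ge_inf; [exists 0 => _ [B' _ <-]|exists B].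
have psi_ge n A x t : (forall B, le B A -> t <= c n A B x) -> t <= psi n A x.
  move=> h; apply: lb_le_inf; first by exists (c n A A x), A => //; exact: wo_refl.
  by move=> _ [B BA <-]; exact: h.
have bpsi n A x : 0 <= psi n A x <= 1.
  rewrite psi_ge//=; apply: (le_trans (psi_le n A A x _)) => //.
  exact: wo_refl.
have ecpsi n x e : 0 < e ->
    \forall y \near x, forall A, `|psi n A x - psi n A y| < e.
  move=> e0; have d0 : 0 < e / 2 / (n.+1%:R *+ 2) by rewrite !divr_gt0// ltr0n.
  apply: filterS (ec x _ d0) => y hy A.
  apply: (@le_lt_trans _ _ (e / 2)); last by lra.
  apply: inf_dist => // [|B BA]; first by exists A; exact: wo_refl.
  apply: (le_trans (clamp_dist _ _)).
  have -> : `|(if B == A then n.+1%:R * phi A x *+ 2 - 1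
      else 1 - n.+1%:R * phi B x *+ 2) - (if B == A then n.+1%:R * phi A y *+ 2 - 1
      else 1 - n.+1%:R * phi B y *+ 2)| = n.+1%:R *+ 2 * `|phi B x - phi B y|.
    have n0 : 0 <= n.+1%:R *+ 2 :> R by rewrite mulrn_wge0.
    rewrite -[X in _ = X * _](ger0_norm n0) -normrM.
    case: eqP => [->|_]; last rewrite -normrN; congr `|_|; lra.
  by rewrite mulrC -ler_pdivlMr// ltW.
have psi_pos n A x : psi n A x != 0 -> 0 < psi n A x.
  by move=> h; rewrite lt_neqAle eq_sym h; case/andP: (bpsi n A x).
have clamp_gt0 t : 0 < clamp t -> 0 < t :> R.
  by rewrite /clamp lt_max ltxx/= lt_min => /andP[].
have psi_phi n A x : psi n A x != 0 -> 1 < n.+1%:R * phi A x *+ 2.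
  move=> /psi_pos h; rewrite -subr_gt0; apply: clamp_gt0.
  by apply: (lt_le_trans h); have := psi_le n A A x (wo_refl wo A);
    rewrite /c eqxx.
have psi_lt n A B x : psi n A x != 0 -> le B A -> B != A ->
    n.+1%:R * phi B x *+ 2 < 1.
  move=> /psi_pos h BA nBA; rewrite -subr_gt0; apply: clamp_gt0.
  by apply: (lt_le_trans h); have := psi_le n A B x BA; rewrite /c (negbTE nBA).
have dis n A B x : psi n A x != 0 -> psi n B x != 0 -> A = B.
  wlog BA : A B / le B A.
    by move=> h hA hB; have [?|?] := wo_total wo A B; [symmetry|]; exact: h.
  move=> hA hB; apply/eqP; rewrite eq_sym; apply: contraT => nAB.
  by have := psi_lt _ _ _ _ hA BA nAB; have := psi_phi _ _ _ hB; lra.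
have /choice[Phi /choice[l hl]] n := labelled_family set0 (bpsi n) (ecpsi n) (dis n).
have /choice[r hr] B : exists A, D B -> C A /\ B `<=` A.
  have [/DC[A CA BA]|nDB] := pselect (D B); last by exists set0.
  by exists A.
exists Phi, (fun n => r \o l n); split=> [n|n x Phi1|x _].
- by have [h _ _] := hl n; apply: labelled_mono h _ => x y /= ->.
- have [_ Phix _] := hl n.
  have /psi_phi h : psi n (l n x) x != 0 by rewrite -Phix Phi1 oner_neq0.
  have /Dphi[DA Ax] : phi (l n x) x != 0.
    by apply: contraTneq h => ->; rewrite mulr0 mul0rn -leNgt.
  by have [CA BA] := hr _ DA; split=> //; exact: BA.
(* The first [A] with [phi A x != 0] works, for [n] large. *)
- have [|A [phiA minA]] := wo_min wo (P := fun A => phi A x != 0).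
    by have [A h] := phi1 x; exists A; rewrite h oner_neq0.
  have phiA0 : 0 < phi A x.
    by rewrite lt_neqAle eq_sym phiA; case/andP: (bphi A x).
  pose n := Num.truncn (phi A x)^-1.
  have hn : 1 <= n.+1%:R * phi A x.
    by rewrite -ler_pdivrMr// div1r ltW// truncnS_gt.
  have psi1 : psi n A x = 1.
    apply/le_anti; case/andP: (bpsi n A x) => _ ->/=; apply: psi_ge => B BA.
    rewrite /c; case: eqP => [_|nBA].
      by rewrite /clamp le_max le_min lexx/=; apply/orP; right; lra.
    suff -> : phi B x = 0 by rewrite mulr0 mul0rn subr0 /clamp le_max le_min lexx orbT.
    apply: contrapT => /eqP /minA AB; apply: nBA; exact: wo_anti BA AB.
  have [_ Phix lA] := hl n.
  by exists n; rewrite Phix (lA A) ?psi1 ?oner_neq0.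
Qed.

End paracompact_selection.

(** * The selection given by a regular sequence *)

Section patching.
Context (R : realType) (X : topologicalType) (T : Type).
Implicit Types (Q : X -> T -> Prop) (U F : set X).

Lemma sigma_selection_local Q U : paracompact X -> (X -> T) ->
  (forall x, exists A, [/\ open A, A x & sigma_selection R Q (A `&` U)]) ->
  sigma_selection R Q U.
Proof.
move=> hX l0 loc; pose C := [set A | open A /\ sigma_selection R Q (A `&` U)].
have covC : open_cover C.
  split=> [A []//|]; apply/seteqP; split=> // x _.
  by have [A [oA Ax selA]] := loc x; exists A.
apply: (@sigma_selection_bind _ _ _ _ (fun x A => C A /\ A x) Q l0 U).
  exact: sigma_selectionW (paracompact_selection R hX covC).
move=> x A [[oA selA] Ax]; exists (A `&` U) => //.
by move=> y [Uy [_ Ay]].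
Qed.

(** [U] itself need not be closed, so the patching is done on each of the closed
    sets [{g >= 1 / (n + 1)}] that exhaust [U], away from which the empty
    selection is good enough. *)
Lemma sigma_selection_functionally_open Q U : paracompact X -> (X -> T) ->
  functionally_open R U ->
  (forall x, U x -> exists A, [/\ open A, A x & sigma_selection R Q A]) ->
  sigma_selection R Q U.
Proof.
move=> hX l0 /functionally_openP[g [cg _ Ug]] loc.
apply: (@sigma_selectionW _ _ _ _ (\bigcup_n [set x | n.+1%:R^-1 <= g x])).
  move=> x /Ug gx; exists (Num.truncn (g x)^-1) => //=.
  by rewrite -[leRHS]invrK lef_pV2 ?posrE ?invr_gt0 ?ltr0n// ltW// truncnS_gt.
apply: sigma_selection_bigcup => n; apply: sigma_selection_local => // x.
have [Ux|nUx] := pselect (U x).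
  have [A [oA Ax selA]] := loc x Ux; exists A; split=> //.
  by apply: sigma_selectionW selA => y [].
exists [set y | g y < n.+1%:R^-1]; split.
- by move/continuousP: cg => /(_ [set t | t < n.+1%:R^-1]); apply; exact: open_lt.
- by rewrite /= ltNge; apply/negP => h; apply: nUx; apply/Ug;
    apply: lt_le_trans h; rewrite invr_gt0 ltr0n.
- rewrite (_ : _ `&` _ = set0); first exact: sigma_selection0.
  by apply/seteqP; split=> // y /= [h1 h2]; have := lt_le_trans h1 h2; rewrite ltxx.
Qed.

Lemma sigma_selection_cst Q U F (t : T) : functionally_open R U ->
  functionally_closed R F -> (forall x, U x -> F x -> Q x t) ->
  sigma_selection R Q (U `&` F).
Proof.
move=> /functionally_openP[g [cg bg Ug]] [h [ch bh Fh]] Qt.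
exists (fun n x => clamp (n.+1%:R * g x) * (1 - h x)), (fun _ _ => t).
split=> [n|n x|x [/Ug gx Fx]].
- split=> [x|x|x _]; last exact: filterE.
    apply: cvgM; last by apply: cvgB; [exact: cvg_cst|exact: ch].
    apply: (@continuous_comp _ _ _ (fun x => n.+1%:R * g x)).
      by apply: cvgM; [exact: cvg_cst|exact: cg].
    exact: clamp_continuous.
  have /andP[c0 c1] := clamp_itv (n.+1%:R * g x); have /andP[h0 h1] := bh x.
  by rewrite mulr_ge0 ?mulr_ile1//; lra.
- have /andP[c0 c1] := clamp_itv (n.+1%:R * g x); have /andP[h0 h1] := bh x.
  move=> e; have c_eq : clamp (n.+1%:R * g x) = 1.
    by apply/le_anti; rewrite c1 /= -[X in X <= _]e ler_piMr//; lra.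
  move: e; rewrite c_eq mul1r => e; apply: Qt.
    apply/Ug; rewrite lt_neqAle; case/andP: (bg x) => -> _; rewrite andbT.
    apply/eqP => gx; move/eqP: c_eq.
    by rewrite -gx mulr0 /clamp maxEle minEle ler10 lexx eq_sym oner_eq0.
  by rewrite Fh /=; lra.
- exists (Num.truncn (g x)^-1); move: Fx; rewrite Fh /= => ->.
  rewrite subr0 mulr1.
  suff h1 : 1 <= (Num.truncn (g x)^-1).+1%:R * g x.
    by rewrite /clamp (min_idPl h1) (max_idPr ler01).
  by rewrite -ler_pdivrMr// div1r ltW// truncnS_gt.
Qed.

End patching.

Lemma diameter_lt (R : realType) (Y : metricType R) (A : set Y) (e : R) y z :
  (diameter A < e%:E)%E -> A y -> A z -> mdist y z < e.
Proof.
move=> dA Ay Az; rewrite -lte_fin; apply: le_lt_trans dA.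
by apply: ereal_sup_ubound; right; exists (y, z).
Qed.

Lemma fragmented_selection (R : realType) (X : topologicalType)
    (Y : metricType R) (f : X -> Y) (eps : R) :
  paracompact X -> functionally_eps_fragmented eps f ->
  sigma_selection R (fun x y => mdist (f x) y < eps) [set: X].
Proof.
move=> hX [I [U [[[oU U0 U1 monU limU] diamU] fU]]].
rewrite -U1; move: (oi_top I); apply: oi_ind => [|i j ij seli|i limi IH].
- by rewrite U0; exact: sigma_selection0 f.
- apply: (@sigma_selectionW _ _ _ _ (U i `|` (U j `&` ~` U i))).
    by move=> x Ujx; have [Uix|nUix] := pselect (U i x); [left|right].
  apply: sigma_selectionU => //.
  have [[x0 [Ux0 nUx0]]|no] := pselect (U j `&` ~` U i !=set0); last first.
    by rewrite (_ : U j `&` _ = set0); [exact: sigma_selection0 f|exact/nonemptyPn].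
  apply: (@sigma_selection_cst _ _ _ _ _ _ (f x0)) => [//||x Ujx nUix]; first exact: fU.
  by apply: diameter_lt (diamU _ _ ij) _ _; [exists x|exists x0].
- apply: sigma_selection_functionally_open => // x.
  rewrite limU// => -[j ji Ujx]; exists (U j); split=> //.
  exact: IH.
Qed.

(** * Sigma-discreteness and measurability *)

Section fine_selection.
Context (R : realType) (X : topologicalType) (Y : metricType R) (f : X -> Y).

(** Selections at all scales, enumerated as one sequence; [r n] is the scale of its
    [n]-th labelling. *)
Definition fine_selection (phi : nat -> X -> R) (l : nat -> X -> Y)
    (r : nat -> R) :=
  [/\ forall n, labelled (phi n) (l n),
      forall n x, phi n x = 1 -> mdist (f x) (l n x) < r n
    & forall x e, 0 < e -> exists2 n, phi n x = 1 & r n < e].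

Lemma fine_selectionP :
  (forall e, 0 < e ->
     sigma_selection R (fun x y => mdist (f x) y < e) [set: X]) ->
  exists phi l r, fine_selection phi l r.
Proof.
move=> self.
have /choice[phi /choice[l h]] n := self n.+1%:R^-1 ltac:(by rewrite invr_gt0 ltr0n).
exists (fun p => phi (unpair p).1 (unpair p).2),
  (fun p => l (unpair p).1 (unpair p).2), (fun p => (unpair p).1.+1%:R^-1).
split=> [p|p x|x e e0].
- by case: (h (unpair p).1).
- by case: (h (unpair p).1) => _ + _; apply.
- pose n := Num.truncn e^-1.
  have [_ _ /(_ x I)[m hm]] := h n.
  exists (pickle (n, m)); rewrite unpairK//=.
  by rewrite -[ltRHS]invrK ltf_pV2 ?posrE ?invr_gt0 ?ltr0n// truncnS_gt.
Qed.

Context (phi : nat -> X -> R) (l : nat -> X -> Y) (r : nat -> R).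
Hypothesis fineP : fine_selection phi l r.

Lemma fine_selection_mem x V : nbhs (f x) V -> exists2 n, phi n x = 1 &
  [set z | mdist z (l n x) < r n] `<=` V.
Proof.
rewrite -nbhs_ballE => -[e e0 eV]; have [_ near_l /(_ x (e / 2))[]] := fineP.
  exact: divr_gt0.
move=> n phin rn; exists n => // z /= zl; apply: eV.
rewrite ballEmdist /=; have := near_l _ _ phin.
have := metric_triangle (f x) (l n x) z; rewrite (metric_sym (l n x)).
move: rn zl; lra.
Qed.

Lemma fine_selection_preimage V : open V -> f @^-1` V =
  \bigcup_n [set x | phi n x = 1 /\ [set z | mdist z (l n x) < r n] `<=` V].
Proof.
move=> oV; apply/seteqP; split=> [x Vfx|x [n _ [phin lV]]].
  have [n phin lV] := fine_selection_mem (open_nbhs_nbhs (conj oV Vfx)).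
  by exists n.
by apply: lV; case: fineP => _ + _; exact.
Qed.

Lemma fine_selection_Fsigma : functionally_Fsigma_measurable R f.
Proof.
move=> V oV; eexists; split; last exact: fine_selection_preimage oV.
move=> n; have [lphi _ _] := fineP.
exact: (functionally_closed_labelled
  (fun y => [set z | mdist z y < r n] `<=` V) (lphi n)).
Qed.

Lemma fine_selection_sigma_discrete : sigma_discrete f.
Proof.
have [lphi _ _] := fineP.
pose B n := [set A | exists2 y, [set: Y] y & A = [set x | phi n x = 1 /\ l n x = y]].
exists B; split=> [n|V oV]; first exact: discrete_labelled (lphi n).
exists [set A | exists2 n, B n A & A `<=` f @^-1` V].
  by move=> A [n BnA _]; exists n.
apply/seteqP; split=> [x|x [A [n _ AV] Ax]]; last exact: AV.
rewrite fine_selection_preimage// => -[n _ [phin lV]].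
exists [set z | phi n z = 1 /\ l n z = l n x] => //; exists n.
  by exists (l n x).
move=> z [phiz lz].
by exists n => //; split=> //; rewrite lz.
Qed.

(** The scale needed at [x] depends on the unknown neighbourhood [G (f x)], so
    the labels [y] whose ball lies in some [G z] are retained at each scale, and
    replaced by such a [z]. *)
Lemma fine_selection_nbhs (G : Y -> set Y) : (forall y, nbhs y (G y)) ->
  sigma_selection R (fun x z => G z (f x)) [set: X].
Proof.
move=> nG; have [lphi near_l _] := fineP.
pose S n y := exists z, [set w | mdist w y < r n] `<=` G z.
have /choice[c hc] (ny : nat * Y) : exists z, S ny.1 ny.2 ->
    [set w | mdist w ny.2 < r ny.1] `<=` G z.
  have [[z hz]|no] := pselect (S ny.1 ny.2); first by exists z.
  by exists ny.2 => /no.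
exists (fun n x => phi n x * (`[< S n (l n x) >])%:R),
  (fun n x => c (n, l n x)); split=> [n|n x|x _].
- by apply: labelled_mono (labelled_filter (S n) (lphi n)) _ => x y ->.
- have [Sx|_] := asboolP (S n (l n x)); last first.
    by rewrite mulr0 => /esym/eqP; rewrite oner_eq0.
  by rewrite mulr1 => phin; apply: (hc (n, l n x)) => //; exact: near_l.
- have [n phin lG] := fine_selection_mem (nG (f x)).
  by exists n; rewrite phin (asboolT _)// ?mul1r//; exists (f x).
Qed.

End fine_selection.

(** * Merging a selection into an exhausting sequence *)

Section exhaustion.
Context (R : realType) (X : topologicalType) (T : Type).
Implicit Types (phi : X -> R) (l : X -> T) (Q : X -> T -> Prop).

(** The two labellings live on the disjoint open sets [{0 < u}] and [{u < 0}],
    and the merged function vanishes on the border [{u = 0}]. *)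
Lemma labelled_merge (u : X -> R) phi phi' l l' : continuous u ->
  (forall x, 0 < u x -> phi x != 0) -> labelled phi l -> labelled phi' l' ->
  labelled (fun x => clamp (u x) + clamp (- u x) * phi' x)
    (fun x => if 0 < u x then l x else l' x).
Proof.
move=> cu uphi [cphi bphi lphi] [cphi' bphi' lphi'].
have cNu : continuous (fun x => - u x) by move=> x; apply: cvgN; exact: cu.
split=> [x|x|x].
- apply: cvgD; first exact: continuous_clamp cu x.
  by apply: cvgM; [exact: continuous_clamp cNu x|exact: cphi'].
- have /andP[p0 p1] := bphi' x; have [ux|ux] := ltP 0 (u x).
    by rewrite (@clamp_le0 _ (- u x)) ?mul0r ?addr0 ?clamp_itv//; lra.
  rewrite (clamp_le0 ux) add0r; have /andP[c0 c1] := clamp_itv (- u x).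
  by rewrite mulr_ge0 ?mulr_ile1.
- have [ux _|ux|ux] := ltgtP 0 (u x).
  + move: (cu x) => /cvgrPdist_lt /(_ _ ux) cux.
    apply: filterS2 cux (lphi _ (uphi _ ux)) => y uy ->.
    by rewrite ifT//; move: uy; rewrite ltr_norml; lra.
  + rewrite (clamp_le0 (ltW ux)) add0r mulf_eq0 negb_or => /andP[_ /lphi' lx].
    have Nux : 0 < - u x by lra.
    move: (cu x) => /cvgrPdist_lt /(_ _ Nux) cux.
    apply: filterS2 cux lx => y uy ->.
    by rewrite ifF//; apply/negbTE; rewrite -leNgt; move: uy; rewrite ltr_norml; lra.
  + by rewrite -ux oppr0 clamp_le0// mul0r addr0 eqxx.
Qed.

(** The labellings [phi 0, .., phi (p - 1)] are merged with decreasing priority: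
    the tail [phi 1, phi 2, ..] is used where [phi 0] stays away from 1, by an
    amount that shrinks as [c] grows.  So [x] is reached through [phi m] as soon
    as every earlier [phi i x] is 1 or far enough from 1 for [c]. *)
Lemma merge_selection Q (l0 : X -> T) (c : R) p (phi : nat -> X -> R)
    (l : nat -> X -> T) : 1 <= c ->
  (forall n, labelled (phi n) (l n)) ->
  (forall n x, phi n x = 1 -> Q x (l n x)) ->
  exists (psi : X -> R) (lam : X -> T), [/\ labelled psi lam,
    forall x, psi x = 1 -> Q x (lam x)
  & forall m x, (m < p)%N -> phi m x = 1 ->
      (forall i, (i < m)%N -> phi i x = 1 \/ 2 <= c * (1 - phi i x)) ->
      psi x = 1].
Proof.
move=> c1; elim: p phi l => [|p IH] phi l lphi Qphi.
  exists (fun=> 0), l0; split=> //; first exact: labelled0.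
  by move=> x /esym/eqP; rewrite oner_eq0.
have [||psi [lam [lpsi Qpsi psi1]]] :=
  IH (fun n => phi n.+1) (fun n => l n.+1); [by []|by move=> n; exact: Qphi|].
(* [u x] equals 1 iff [phi 0 x] does, and is at most [-1] iff
   [2 <= c * (1 - phi 0 x)]. *)
pose u x := 1 - c * (1 - phi 0%N x); have [cphi bphi _] := lphi 0%N.
have cu : continuous u.
  move=> x; apply: cvgB; first exact: cvg_cst.
  apply: cvgM; first exact: cvg_cst.
  by apply: cvgB; [exact: cvg_cst|exact: cphi].
exists (fun x => clamp (u x) + clamp (- u x) * psi x),
  (fun x => if 0 < u x then l 0%N x else lam x); split.
- apply: labelled_merge (lphi 0%N) lpsi => // x; rewrite /u.
  by apply: contraTneq => ->; rewrite -leNgt; lra.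
- move=> x; have [ux|ux] := ltP 0 (u x).
    rewrite (@clamp_le0 _ (- u x)) ?mul0r ?addr0; last lra.
    move=> /clamp_eq1; rewrite /u => h; apply: Qphi.
    have : c * (1 - phi 0%N x) <= 0 by lra.
    rewrite pmulr_rle0; last lra.
    by have /andP[] := bphi x; lra.
  rewrite (clamp_le0 ux) add0r => e; apply: Qpsi.
  have /andP[c0 c1'] := clamp_itv (- u x); have [_ /(_ x)/andP[p0 p1] _] := lpsi.
  by apply/le_anti; rewrite p1/= -[X in X <= _]e ler_piMl.
- move=> m x mp phim hm.
  have case0 : phi 0%N x = 1 -> clamp (u x) + clamp (- u x) * psi x = 1.
    rewrite /u => ->; rewrite subrr mulr0 subr0 clamp_ge1// clamp_le0; last lra.
    by rewrite mul0r addr0.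
  case: m mp phim hm => [|m] mp phim hm; first exact: case0.
  have [/case0//|u2] := hm 0%N isT.
  rewrite clamp_le0 ?clamp_ge1 ?mul1r ?add0r; try by rewrite /u; lra.
  by apply: (psi1 m) => // i im; exact: (hm i.+1).
Qed.

Lemma exhausting_selection Q : (X -> T) -> sigma_selection R Q [set: X] ->
  exists (psi : nat -> X -> R) (lam : nat -> X -> T),
  [/\ forall k, labelled (psi k) (lam k),
    forall k x, psi k x = 1 -> Q x (lam k x)
  & forall x, \forall k \near \oo, psi k x = 1].
Proof.
move=> l0 [phi [l [lphi Qphi covphi]]].
have /choice[psi /choice[lam h]] k := @merge_selection Q l0 k.+1%:R k phi l
  ltac:(by rewrite ler1n) lphi Qphi.
exists psi, lam; split=> [k|k|x]; [by case: (h k)|by case: (h k)|].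
have [m phim] := covphi x I.
have far i : `I_m i -> \forall k \near \oo,
    phi i x = 1 \/ 2 <= k.+1%:R * (1 - phi i x).
  move=> _; have [->|phi_neq1] := eqVneq (phi i x) 1; first by apply: filterE; left.
  have d0 : 0 < 1 - phi i x.
    by rewrite subr_gt0 lt_neqAle phi_neq1; case: (lphi i) => _ /(_ x)/andP[].
  exists (Num.truncn (2 / (1 - phi i x))) => // k /= hk; right.
  rewrite -ler_pdivrMr//; apply: le_trans (ltW (truncnS_gt _)) _.
  by rewrite ler_nat.
have farm := filter_finite eventually_filter (finite_II m) far.
have mk : \forall k \near \oo, (m < k)%N by exists m.+1.
by apply: filterS2 mk farm => k mk hk; case: (h k) => _ _; apply; [exact: mk|..].
Qed.

End exhaustion.

(** * Bridges between values of a continuous map *)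

Section bridges.
Context (R : realType) (X Y : topologicalType).
Implicit Types (W : set Y) (a b c : Y) (h : X -> Y) (u : X -> R).

Definition bridges W a b := forall A B : set X,
  functionally_closed R A -> functionally_closed R B -> A `&` B = set0 ->
  exists h, [/\ continuous h, forall x, W (h x),
    forall x, A x -> h x = a & forall x, B x -> h x = b].

Lemma bridges_sym W a b : bridges W a b -> bridges W b a.
Proof.
move=> ab A B cA cB AB; have [|h [ch Wh ha hb]] := ab B A cB cA.
  by rewrite setIC.
by exists h.
Qed.

Lemma continuous_glue u h1 h2 : continuous u -> continuous h1 ->
  continuous h2 -> (forall x, u x = 0 -> h1 x = h2 x) ->
  continuous (fun x => if u x < 0 then h1 x else h2 x).
Proof.
move=> cu c1 c2 h12 x V /=; rewrite /nbhs/=.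
have [ux|ux|ux] := ltgtP (u x) 0 => nV.
- have Nux : 0 < - u x by lra.
  move: (cu x) => /cvgrPdist_lt /(_ _ Nux) cux.
  apply: filterS2 cux (c1 x V nV) => y uy Vy /=.
  by rewrite ifT//; move: uy; rewrite ltr_norml; lra.
- move: (cu x) => /cvgrPdist_lt /(_ _ ux) cux.
  apply: filterS2 cux (c2 x V nV) => y uy Vy /=.
  by rewrite ifF//; apply/negbTE; rewrite -leNgt; move: uy; rewrite ltr_norml; lra.
- have nV1 : nbhs (h1 x) V by rewrite (h12 _ ux).
  have n1 : nbhs x (h1 @^-1` V) := c1 x V nV1.
  have n2 : nbhs x (h2 @^-1` V) := c2 x V nV.
  by apply: filterS2 n1 n2 => y V1 V2 /=; case: ifP.
Qed.

(** The two maps are glued along the zero set of a function [u] that is negative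
    on [A] and positive on [B]: the first map equals [b] on [{0 <= u}], the
    second one on [{u <= 0}]. *)
Lemma bridges_trans W a b c : bridges W a b -> bridges W b c -> bridges W a c.
Proof.
move=> ab bc A B cA cB AB; have [gA [cgA bgA AE]] := cA.
have [gB [cgB bgB BE]] := cB.
pose u x := gA x - gB x.
have cu : continuous u by move=> x; apply: cvgB; [exact: cgA|exact: cgB].
have cNu : continuous (fun x => - u x) by move=> x; apply: cvgN; exact: cu.
have uA x : A x -> u x < 0.
  move=> Ax; have gA0 : gA x = 0 by move: Ax; rewrite AE.
  rewrite /u gA0 sub0r oppr_lt0 lt_neqAle; case/andP: (bgB x) => -> _.
  rewrite andbT; apply/eqP => gB0.
  by have : set0 x by rewrite -AB; split=> //; rewrite BE.
have uB x : B x -> 0 < u x.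
  move=> Bx; have gB0 : gB x = 0 by move: Bx; rewrite BE.
  rewrite /u gB0 subr0 lt_neqAle; case/andP: (bgA x) => -> _.
  rewrite andbT; apply/eqP => gA0.
  by have : set0 x by rewrite -AB; split=> //; rewrite AE.
have [|h1 [c1 W1 h1a h1b]] := ab _ _ cA (functionally_closed_le0 cNu).
  by apply/seteqP; split=> // x [/uA + /=]; lra.
have [|h2 [c2 W2 h2b h2c]] := bc _ _ (functionally_closed_le0 cu) cB.
  by apply/seteqP; split=> // x [/= + /uB]; lra.
exists (fun x => if u x < 0 then h1 x else h2 x); split.
- apply: continuous_glue => // x ux.
  by rewrite h1b ?h2b//= ux ?oppr0.
- by move=> x; case: ifP.
- by move=> x Ax; rewrite uA// h1a.
- by move=> x Bx; rewrite ltNge ltW ?uB//= h2c.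
Qed.

(** Where [phi] does not vanish, [h] has a locally constant value and can be
    rebuilt, separately for each label, as a map from this value, on
    [{phi <= 1 / 4}], to the new one, on [{1 / 2 <= phi}].  The old map is kept
    on [{phi <= 1 / 4}], where the two agree unless [phi] vanishes. *)
Lemma bridge_modification T h (phi : X -> R) (l : X -> T) (a b : T -> Y)
    (W : T -> set Y) :
  continuous h -> labelled phi l ->
  (forall x, phi x != 0 -> h x = a (l x)) ->
  (forall x, phi x != 0 -> bridges (W (l x)) (a (l x)) (b (l x))) ->
  exists h', [/\ continuous h', forall x, 2^-1 <= phi x -> h' x = b (l x)
    & forall x, h' x = h x \/ phi x != 0 /\ W (l x) (h' x)].
Proof.
move=> ch lphi ha ab; have [cphi bphi hl] := lphi.
pose phit t x := phi x * (`[< l x = t >])%:R.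
have cphit t : continuous (phit t).
  by have [] := labelled_filter (fun s => s = t) lphi.
have /choice[H hH] t : exists g, (exists2 x, phi x != 0 & l x = t) ->
  [/\ continuous g, forall x, W t (g x), forall x, phit t x <= 4^-1 -> g x = a t
    & forall x, 2^-1 <= phit t x -> g x = b t].
  have [[x phix lx]|no] := pselect (exists2 x, phi x != 0 & l x = t); last by exists h.
  have [|||g [cg Wg ga gb]] := ab x phix [set x | phit t x - 4^-1 <= 0]
      [set x | 2^-1 - phit t x <= 0].
  - apply: functionally_closed_le0 => y.
    by apply: cvgB; [exact: cphit|exact: cvg_cst].
  - apply: functionally_closed_le0 => y.
    by apply: cvgB; [exact: cvg_cst|exact: cphit].
  - by apply/seteqP; split=> // y /= []; lra.
  exists g => _; split=> // [y|y hy|y hy]; rewrite -lx //.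
  + by apply: ga => /=; lra.
  + by apply: gb => /=; lra.
have phi_pos x : 4^-1 < phi x -> phi x != 0 by move=> h0; rewrite gt_eqF//; lra.
have phitE x : phit (l x) x = phi x by rewrite /phit asboolT// mulr1.
exists (fun x => if 4^-1 < phi x then H (l x) x else h x); split.
- move=> x V /=; rewrite /nbhs/=.
  have [phix|phix|phix] := ltgtP 4^-1 (phi x) => nV.
  + have p0 := phi_pos _ phix.
    have [cg _ _ _] := hH (l x) (ex_intro2 _ _ x p0 erefl).
    have d0 : 0 < phi x - 4^-1 by lra.
    move: (cphi x) => /cvgrPdist_lt /(_ _ d0) cx.
    apply: filterS3 cx (hl _ p0) (cg x V nV) => y hy ly Vy /=.
    by rewrite ly ifT//; move: hy; rewrite ltr_norml; lra.
  + have d0 : 0 < 4^-1 - phi x by lra.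
    move: (cphi x) => /cvgrPdist_lt /(_ _ d0) cx.
    apply: filterS2 cx (ch x V nV) => y hy Vy /=.
    by rewrite ifF//; apply/negbTE; rewrite -leNgt; move: hy; rewrite ltr_norml; lra.
  + have p0 : phi x != 0 by rewrite -phix; lra.
    have [cg _ ga _] := hH (l x) (ex_intro2 _ _ x p0 erefl).
    have nV' : nbhs (H (l x) x) V by rewrite ga -?ha// phitE -phix.
    have n1 : nbhs x (H (l x) @^-1` V) := cg x V nV'.
    have n2 : nbhs x (h @^-1` V) := ch x V nV.
    by apply: filterS3 (hl _ p0) n1 n2 => y ly V1 V2 /=; rewrite ly; case: ifP.
- move=> x phix; have p4 : 4^-1 < phi x by lra.
  have [_ _ _ gb] := hH (l x) (ex_intro2 _ _ x (phi_pos _ p4) erefl).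
  by rewrite p4 gb// phitE.
- move=> x; case: ifP => [p4|_]; last by left.
  have p0 := phi_pos _ p4.
  by have [_ Wg _ _] := hH (l x) (ex_intro2 _ _ x p0 erefl); right.
Qed.

End bridges.

(** * Pointwise approximation by continuous maps *)

Section baire_one.
Context (R : realType) (X : topologicalType) (Y : metricType R) (f : X -> Y).

Let rad (n : nat) : R := 2^-1 ^+ n.

Let radS n : rad n = rad n.+1 + rad n.+1.
Proof. by rewrite /rad exprS; lra. Qed.

Let rad_gt0 n : 0 < rad n.
Proof. by rewrite exprn_gt0// invr_gt0. Qed.

Let rad_small e : 0 < e -> exists n, 6 * rad n < e.
Proof.
move=> e0; exists (Num.truncn (6 / e)).
rewrite mulrC -ltr_pdivlMr// /rad exprVn -[ltRHS]invrK invf_div.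
rewrite ltf_pV2 ?posrE ?exprn_gt0 ?divr_gt0//.
apply: lt_le_trans (truncnS_gt _) _.
by rewrite -natrX ler_nat ltn_expl.
Qed.

Section approximation.
Context (G : nat -> Y -> set Y).
Hypothesis Gmem : forall n y, G n y y.
Hypothesis G_ball : forall n y z, G n y z -> mdist y z < rad n.
Hypothesis G_bridge : forall n y z, G n y z ->
  bridges R X [set w | mdist y w < rad n] y z.
Hypothesis Y_bridge : forall y z, bridges R X [set: Y] y z.
Context (psi : nat -> X -> R) (lam : nat -> X -> Y).
Hypothesis lpsi : forall n, labelled (psi n) (lam n).
Hypothesis Gpsi : forall n x, psi n x = 1 -> G n (lam n x) (f x).

(** Induction on [N].  The map [h] takes the value [y x] where
    [2^-1 <= theta x], and [y x] lies in [G N (c x)] with [c x] the label of level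
    [N].  The next map is obtained by moving the value [y x], within the ball of
    radius [rad N] about [c x], to a point common to [G N (c x)] and
    [G N.+1 (lam N.+1 x)]; such a point exists where all labellings are valid,
    since [f x] is one.  Each modification is confined to the set where [h] is
    already locally constant, and displaces [h] by at most [2 * rad N], which the
    term [4 * rad N] accounts for. *)
Lemma tower_approximation (y0 : Y) N : exists h : X -> Y, continuous h /\
  forall n x, (n <= N)%N -> (forall i, (i <= n)%N -> psi i x = 1) ->
    mdist (h x) (f x) <= 6 * rad n - 4 * rad N.
Proof.
suff [h [theta [c [y [ch _ _ _ [_ herr]]]]]] :
  exists (h : X -> Y) (theta : X -> R) (c y : X -> Y),
    [/\ continuous h, labelled theta (fun x => (c x, y x)),
      forall x, 2^-1 <= theta x -> h x = y x,
      forall x, theta x != 0 -> G N (c x) (y x) &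
      (forall x, (forall i, (i <= N)%N -> psi i x = 1) -> theta x = 1 /\ c x = lam N x) /\
      forall n x, (n <= N)%N -> (forall i, (i <= n)%N -> psi i x = 1) ->
        mdist (h x) (f x) <= 6 * rad n - 4 * rad N] by exists h.
elim: N => [|N [h [theta [c [y [ch ltheta hy Gcy [theta1 herr]]]]]]].
  have [|x _|x _|h [ch hlam _]] := @bridge_modification R X Y Y (fun=> y0) (psi 0%N)
      (lam 0%N) (fun=> y0) id (fun=> [set: Y]) _ (lpsi 0%N).
  - by move=> x; exact: cvg_cst.
  - by [].
  - exact: Y_bridge.
  exists h, (psi 0%N), (lam 0%N), (lam 0%N); split=> //.
  - by apply: labelled_mono (lpsi 0%N) _ => x x' ->.
  - by split=> [x /(_ 0%N)->//|] [|n] x// _ h1; rewrite hlam ?h1//; last lra;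
      have := G_ball (Gpsi (h1 0%N isT)); rewrite /rad expr0; lra.
pose S (p : (Y * Y) * Y) := exists w, G N p.1.1 w /\ G N.+1 p.2 w.
have /choice[w hw] p : exists w, S p -> G N p.1.1 w /\ G N.+1 p.2 w.
  have [[w hw]|no] := pselect (S p); first by exists w.
  by exists p.2.
pose l x := ((c x, y x), lam N.+1 x).
(* The cozero set of [inner] is [{2^-1 < theta}], where [h] equals [y]. *)
pose inner x := clamp (2 * theta x - 1).
have linner : labelled inner (fun x => (c x, y x)).
  apply: (labelled_comp (g := fun t => clamp (2 * t - 1))) ltheta.
  - apply: continuous_clamp => t; apply: cvgB; last exact: cvg_cst.
    by apply: cvgM; [exact: cvg_cst|exact: cvg_id].
  - by move=> t _; exact: clamp_itv.
  - by rewrite clamp_le0//; lra.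
pose theta' x := inner x * psi N.+1 x * (`[< S (l x) >])%:R.
have ltheta' : labelled theta' l.
  exact: (labelled_filter S (labelled_pair linner (lpsi N.+1))).
have theta'_neq0 x : theta' x != 0 -> 2^-1 < theta x /\ S (l x).
  rewrite /theta'; have [Sx|_] := asboolP (S (l x)); last by rewrite mulr0 eqxx.
  rewrite mulr1 mulf_eq0 negb_or => /andP[/clamp_neq0 h0 _]; split=> //; lra.
have Gy x : 2^-1 <= theta x -> G N (c x) (y x).
  by move=> h0; apply: Gcy; rewrite gt_eqF//; lra.
have [x h0|x h0|h' [ch' hw' hh']] := @bridge_modification R X Y _ h theta' l
    (fun p => p.1.2) w (fun p => [set z | mdist p.1.1 z < rad N]) ch ltheta'.
- by have [h1 _] := theta'_neq0 _ h0; apply: hy; exact: ltW.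
- have [h1 /hw[Gw _]] := theta'_neq0 _ h0.
  apply: bridges_trans (G_bridge Gw); apply: bridges_sym.
  by apply: G_bridge; apply: Gy; exact: ltW.
(* Where [h' x] and [h x] differ, both lie within [rad N] of [c x]. *)
have close x : mdist (h' x) (h x) <= 2 * rad N.
  have [->|[h0 hc]] := hh' x; first by rewrite mdistxx; have := rad_gt0 N; lra.
  have [h1 _] := theta'_neq0 _ h0; rewrite (hy x) 1?ltW//.
  have := G_ball (Gy x (ltW h1)); move: hc => /=.
  have := metric_triangle (h' x) (c x) (y x); rewrite (metric_sym (h' x) (c x)).
  by rewrite -/(l x) /=; lra.
have theta'1 x : (forall i, (i <= N.+1)%N -> psi i x = 1) -> theta' x = 1.
  move=> h1; have [th cx] := theta1 x (fun i iN => h1 i (leqW iN)).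
  rewrite /theta' /inner th h1// mulr1 clamp_ge1 ?mul1r; last lra.
  rewrite asboolT//; exists (f x) => /=; rewrite cx; split; apply: Gpsi; exact: h1.
exists h', theta', (lam N.+1), (w \o l); split=> //.
- by apply: labelled_mono ltheta' _ => x x' e; rewrite /= e; case: e => _ _ ->.
- by move=> x h0; have [_ /hw[]] := theta'_neq0 _ h0.
- split=> [x h1|n x]; first by split=> //; exact: theta'1.
  rewrite leq_eqVlt => /predU1P[->|]; last first.
    rewrite ltnS => nN h1; have := herr n x nN h1; have := close x.
    have := metric_triangle (h' x) (h x) (f x); rewrite (radS N); lra.
  move=> h1; have t1 := theta'1 x h1.
  rewrite hw' ?t1; last lra.
  have [_ /hw[_ Gw]] := theta'_neq0 x ltac:(by rewrite t1 oner_neq0).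
  have := G_ball Gw; have := G_ball (Gpsi (h1 _ (leqnn _))).
  have := metric_triangle (w (l x)) (lam N.+1 x) (f x).
  by rewrite (metric_sym (w _) (lam _ _)) /=; lra.
Qed.

End approximation.

Lemma selection_baire_one :
  (forall G : Y -> set Y, (forall y, nbhs y (G y)) ->
     sigma_selection R (fun x z => G z (f x)) [set: X]) ->
  weak_adhesive R X Y -> locally_weak_adhesive R X Y -> baire_one f.
Proof.
move=> self wY lwY.
have [[x0 _]|noX] := pselect ([set: X] !=set0); last first.
  exists (fun=> f); split=> [_ x|x]; by case: noX; exists x.
have /choice[G hG] (ny : nat * Y) : exists U : set Y, [/\ nbhs ny.2 U,
    U `<=` [set z | mdist ny.2 z < rad ny.1] &
    forall z, U z -> bridges R X [set w | mdist ny.2 w < rad ny.1] ny.2 z].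
  have nB : nbhs ny.2 [set z | mdist ny.2 z < rad ny.1].
    by rewrite -ballEmdist; exact: nbhsx_ballx.
  have [U [nU UB hU]] := lwY _ _ nB; exists U; split=> // z Uz A B cA cB AB.
  exact: hU.
have /choice[psi /choice[lam h]] n := exhausting_selection f
  (self (fun y => G (n, y)) (fun y => let: And3 nG _ _ := hG (n, y) in nG)).
have /choice[F hF] k := @tower_approximation (fun n y => G (n, y))
  (fun n y => let: And3 nG _ _ := hG (n, y) in nbhs_singleton nG)
  (fun n y => let: And3 _ GB _ := hG (n, y) in GB)
  (fun n y => let: And3 _ _ Gb := hG (n, y) in Gb)
  ltac:(by move=> y z A B cA cB AB; have [g [cg ga gb]] := wY y z A B cA cB AB; exists g)
  (fun n => psi n k) (fun n => lam n k)
  (fun n => let: And3 lpsi _ _ := h n in lpsi k)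
  (fun n => let: And3 _ Gpsi _ := h n in Gpsi k)
  (f x0) k.
exists F; split=> [k|x]; first by case: (hF k).
apply/metricType_numDomainType.fcvgrPdist_lt => e e0.
have [n ne] := rad_small e0.
have evn i : `I_n.+1 i -> \forall k \near \oo, psi i k x = 1.
  by move=> _; case: (h i) => _ _; apply.
have evs := filter_finite eventually_filter (finite_II n.+1) evn.
have nk : \forall k \near \oo, (n <= k)%N by exists n.
apply: filterS2 nk evs => k nk hk; change (mdist (f x) (F k x) < e).
rewrite metric_sym.
have [_ /(_ n x nk)] := hF k.
move=> /(_ (fun i (ni : (i <= n)%N) => hk i ni)).
by have := rad_gt0 k; lra.
Qed.

End baire_one.

(** * Countable regular sequences on Lindelof spaces *)

Section lindelof_functionally_open.
Context (R : realType) (X : topologicalType).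

(** A functionally open set is a countable union of closed subsets of [X], and
    each of them inherits the Lindelof property. *)
Lemma lindelof_functionally_open (W : set X) (C : set (set X)) :
  lindelof X -> functionally_open R W -> C `<=` open ->
  W `<=` \bigcup_(A in C) A ->
  exists D, [/\ D `<=` C, countable D & W `<=` \bigcup_(A in D) A].
Proof.
move=> hX /functionally_openP[g [cg bg Wg]] oC WC.
pose V n := [set x | g x < n.+1%:R^-1].
have oV n : open (V n).
  by move/continuousP: cg => /(_ [set t | t < n.+1%:R^-1]); apply; exact: open_lt.
have /choice[E hE] n : exists D, [/\ D `<=` C `|` [set V n], countable D & open_cover D].
  apply: hX; split=> [A [/oC//|->//]|]; apply/seteqP; split=> // x _.
  have [Wx|nWx] := pselect (W x).
    by have [A CA Ax] := WC x Wx; exists A => //; left.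
  exists (V n); [by right|rewrite /V/= ltNge; apply/negP => h; apply: nWx; apply/Wg].
  by apply: lt_le_trans h; rewrite invr_gt0 ltr0n.
exists (C `&` \bigcup_n E n); split=> [A []//||x Wx].
  apply: sub_countable (subset_card_le (@subIsetr _ _ _)) _.
  by apply: bigcup_countable => // n _; have [] := hE n.
pose n := Num.truncn (g x)^-1; have [EC _ [_ covE]] := hE n.
have : [set: X] x by [].
rewrite -covE => -[A EA Ax]; have [CA|AV] := EC _ EA.
  by exists A => //; split=> //; exists n.
move: Ax; rewrite AV /V/= ltNge => /negP[]; move/Wg : Wx => gx.
by rewrite -[leRHS]invrK lef_pV2 ?posrE ?invr_gt0 ?ltr0n// ltW// truncnS_gt.
Qed.

End lindelof_functionally_open.

Section first_occurrences.
Context (R : realType) (X : topologicalType) (I : ordinal_interval)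
  (U : I -> set X).
Hypothesis regU : regular_sequence U.
Implicit Types i j k : I.

Let wo := @oi_wo I.

Lemma regular_sequence_mono i j : oi_le i j -> U i `<=` U j.
Proof.
case: regU => _ _ U1 mon _ ij; have [->|jtop] := pselect (j = oi_top I).
  by rewrite U1.
by apply: mon => //; split=> //; exact: oi_topP.
Qed.

Definition fresh i := forall j, oi_lt j i -> U j <> U i.

Lemma fresh_repr i : exists2 j, fresh j & oi_le j i /\ U j = U i.
Proof.
have [|j [Uj minj]] := wo_min wo (P := fun j => U j = U i); first by exists i.
exists j; last by split=> //; apply: minj.
by move=> k /oi_ltNge nk Uk; apply/nk/minj; rewrite Uk.
Qed.

Lemma fresh_inj i j : fresh i -> fresh j -> U i = U j -> i = j.
Proof.
wlog ij : i j / oi_le i j.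
  move=> h hi hj Uij; have [?|?] := wo_total wo i j; first exact: h.
  by symmetry; exact: h.
by move=> _ hj Uij; apply: contrapT => neq; apply: (hj i).
Qed.

(** Induction on the index.  At a limit [k], countably many values [U j] with
    [j < k] cover [U k]; a fresh index up to [k] that lies below none of these
    [j] already has the value [U k], and only one fresh index can have it. *)
Lemma countable_fresh : lindelof X -> (forall i, functionally_open R (U i)) ->
  countable [set i | fresh i].
Proof.
move=> hX fU; have [oU _ _ _ limU] := regU.
suff h : forall k, countable [set i | fresh i /\ oi_le i k].
  apply: sub_countable (subset_card_le _) (h (oi_top I)) => i fi.
  by split=> //; exact: oi_topP.
apply: oi_ind => [|i j [_ ij] ci|k limk IH].
- apply: sub_countable (subset_card_le _) (countable1 (oi_bot I)) => i [_ i0].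
  exact: (wo_anti wo i0 (oi_botP i)).
- apply: (@sub_countable _ _ _ ([set i' | fresh i' /\ oi_le i' i] `|` [set j])).
    apply: subset_card_le => k [fk kj].
    have [|/oi_ltNge/ij jk] := pselect (oi_le k i); first by left.
    by right; exact: (wo_anti wo kj jk).
  by apply: countable_setU => //; exact: countable1.
have Uk := limU _ limk.
have [|| D [DC cD kD]] := @lindelof_functionally_open R X (U k)
    [set A | exists2 j, oi_lt j k & A = U j] hX (fU k).
- by move=> _ [j _ ->]; exact: oU.
- by rewrite Uk => x [j jk Ujx]; exists (U j) => //; exists j.
have /choice[ix hix] A : exists j, D A -> oi_lt j k /\ A = U j.
  have [/DC[j jk ->]|nDA] := pselect (D A); last by exists k.
  by exists j.
apply: (@sub_countable _ _ _ (\bigcup_(A in D) [set i | fresh i /\ oi_le i (ix A)]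
  `|` [set i | fresh i /\ U i = U k])).
  apply: subset_card_le => i [fi ik].
  have [[A DA iA]|no] := pselect (exists2 A, D A & oi_le i (ix A)).
    by left; exists A.
  right; split=> //; apply/seteqP; split; first exact: regular_sequence_mono.
  move=> x /kD[A DA Ax]; have [_ AE] := hix _ DA; rewrite AE in Ax.
  apply: regular_sequence_mono Ax.
  by have [//|iA] := wo_total wo (ix A) i; case: no; exists A.
apply: countable_setU.
  by apply: bigcup_countable => // A DA; apply: IH; exact: (hix _ DA).1.
have [[i0 [fi0 Ui0]]|no] := pselect ([set i | fresh i /\ U i = U k] !=set0).
  apply: sub_countable (subset_card_le _) (countable1 i0) => i [fi Ui].
  by apply: fresh_inj => //; rewrite Ui Ui0.
by rewrite (_ : [set i | _] = set0) //; exact/nonemptyPn.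
Qed.

Let J := {i : I | fresh i}.
Let leJ : rel J := fun i j : J => oi_le (sval i) (sval j).

Let J_inj (i j : J) : sval i = sval j -> i = j.
Proof.
by case: i j => [i fi] [j fj] /= e; subst j; congr exist; exact: Prop_irrelevance.
Qed.

Let J_wo : well_order leJ.
Proof.
move=> A [i0 Ai0].
have [|k [[i [Ai ik]] mink]] :=
  wo_min wo (P := fun k => exists i : J, i \in A /\ sval i = k).
  by exists (sval i0), i0.
exists i; split.
  by split=> // j Aj; rewrite /leJ ik; apply: mink; exists j.
move=> j [Aj minj]; apply: J_inj; apply: (wo_anti wo); last exact: minj.
by rewrite ik; apply: mink; exists j.
Qed.

Let fresh_bot : fresh (oi_bot I).
Proof. by move=> j /oi_ltNge; have := oi_botP j. Qed.

Let J_top : {i : J | forall j : J, leJ j i}.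
Proof.
apply: cid; have [i fi [_ Ui]] := fresh_repr (oi_top I).
exists (exist _ i fi) => -[j fj]; rewrite /leJ /=; apply: contrapT => /oi_ltNge ij.
have [_ _ U1 _ _] := regU; apply: (fj i ij); apply/seteqP; split.
  by apply: regular_sequence_mono; case: ij.
by rewrite Ui U1.
Qed.

(** The fresh indices with the induced order.  The last one is the first index
    at which [U] reaches the whole space; later indices are not fresh. *)
Definition fresh_interval : ordinal_interval :=
  @OrdinalInterval J leJ J_wo (exist _ (oi_bot I) fresh_bot) (sval J_top)
    (fun i : J => oi_botP (sval i)) (svalP J_top).

Definition fresh_sequence (i : fresh_interval) : set X := U (sval i).

Let ltJ (i j : fresh_interval) : oi_lt i j <-> oi_lt (sval i) (sval j).
Proof.
by split=> -[ij neq]; split=> // e; apply: neq; [exact: J_inj|rewrite e].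
Qed.

Let fresh_below j (i : fresh_interval) : oi_lt j (sval i) ->
  exists2 k : fresh_interval, oi_lt k i & U (sval k) = U j.
Proof.
move=> ji; have [k fk [kj Uk]] := fresh_repr j.
exists (exist _ k fk) => //; apply/ltJ => /=; apply/oi_ltNge => ik.
exact: (oi_ltNge _ _).2 ji (wo_trans wo ik kj).
Qed.

Let fresh_limit (i : fresh_interval) : oi_limit i -> oi_limit (sval i).
Proof.
move=> [i0 nosucc]; split=> [e|[j [ji jmin]]]; first exact/i0/J_inj.
have [k ki Uk] := fresh_below ji; apply: nosucc; exists k; split=> // m km.
move/ltJ: km => km; apply: jmin; apply/oi_ltNge => mj.
apply: (svalP m _ km); apply/seteqP; split.
  by apply: regular_sequence_mono; case: km.
by rewrite Uk; exact: regular_sequence_mono.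
Qed.

Lemma fresh_regular : regular_sequence fresh_sequence.
Proof.
have [oU U0 U1 _ limU] := regU; split=> [i||| i j ij _|i limi].
- exact: oU.
- exact: U0.
- have [i fi [_ Ui]] := fresh_repr (oi_top I).
  apply/seteqP; split=> // x _.
  apply: (regular_sequence_mono (svalP J_top (exist _ i fi))).
  by rewrite /= Ui U1.
- exact: regular_sequence_mono.
- rewrite /fresh_sequence limU; last exact: fresh_limit.
  apply/seteqP; split=> x [j ji Ujx].
    by have [k ki Uk] := fresh_below ji; exists k => //; rewrite Uk.
  by exists (sval j) => //; exact/ltJ.
Qed.

(** The predecessor [i] of [j] among the fresh indices need not precede [j]
    immediately in [I], but every index between them has the value of [U] at
    [i]. In particular [j] is no limit in [I], or [U] would not change at [j]. *)
Lemma fresh_succ (i j : fresh_interval) : oi_succ i j ->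
  exists k, oi_succ k (sval j) /\ U k = U (sval i).
Proof.
have [oU U0 U1 _ limU] := regU.
move=> [ij minj].
have belowE k : oi_lt k (sval j) -> U k `<=` U (sval i).
  move=> kj; have [m mj <-] := fresh_below kj.
  apply: regular_sequence_mono; apply: contrapT => /oi_ltNge /ltJ /minj jm.
  exact: (oi_ltNge _ _).2 ((ltJ _ _).1 mj) jm.
have Uij : U (sval i) <> U (sval j) by apply: (svalP j); exact/ltJ.
have [[k kj]|no] := pselect (exists k, oi_succ k (sval j)).
  exists k; split=> //; apply/seteqP; split; first by apply: belowE; case: kj.
  apply: regular_sequence_mono; apply: contrapT => /oi_ltNge ki.
  exact: (oi_ltNge _ _).2 ((ltJ _ _).1 ij) (kj.2 _ ki).
have limj : oi_limit (sval j).
  split=> // j0; have /ltJ := ij; rewrite j0 => /oi_ltNge; apply.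
  exact: oi_botP.
case: Uij; apply/seteqP; split.
  by apply: regular_sequence_mono; case: ij.
by rewrite limU// => x [k kj Ukx]; exact: belowE kj _ Ukx.
Qed.

End first_occurrences.

Lemma lindelof_fragmented (R : realType) (X : topologicalType)
    (Y : metricType R) (f : X -> Y) : lindelof X ->
  functionally_fragmented f -> countably_functionally_fragmented f.
Proof.
move=> hX hf eps /hf[I [U [[regU diamU] fU]]].
exists (fresh_interval regU), (fresh_sequence (regU := regU)); split.
- have /countable_injP[n inj] := countable_fresh regU hX fU.
  apply/countable_injP; exists (fun i => n (sval i)) => -[i fi] [j fj] _ _ /= nij.
  have e : i = j by apply: inj => //; exact: mem_set.
  by subst j; congr exist; exact: Prop_irrelevance.
- split; first exact: fresh_regular.
  move=> i j /fresh_succ[k [kj Uk]]; rewrite /fresh_sequence -Uk.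
  exact: diamU.
- by move=> i; exact: fU.
Qed.

Theorem theorem3 (R : realType) (X : topologicalType) (Y : metricType R)
    (f : X -> Y) (hX : paracompact X) (hf : functionally_fragmented f) :
  (sigma_discrete f /\ functionally_Fsigma_measurable R f) /\
  (weak_adhesive R X Y -> locally_weak_adhesive R X Y -> baire_one f) /\
  (lindelof X -> countably_functionally_fragmented f).
Proof.
have [|phi [l [r fine]]] := @fine_selectionP R X Y f.
  by move=> e e0; exact: fragmented_selection (hf e e0).
split; [split|split].
- exact: fine_selection_sigma_discrete fine.
- exact: fine_selection_Fsigma fine.
- apply: selection_baire_one => G nG; exact: fine_selection_nbhs fine G nG.
- by move=> hL; exact: lindelof_fragmented.
Qed.
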